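(* Let $n\ge2$, $0\le s\le n-1$, and let $A$ be an $s$-dimensional badly approximable affine subspace of $\mathbb{R}^n$. Put $w_{s,n}=\frac{s+1}{n-s}$. Then: (i) for any $\boldsymbol{\xi}\in A$ one has $\hat{\omega}(\boldsymbol{\xi})\le w_{s,n}$; (ii) if $s\ge1$ then, for any totally irrational $\boldsymbol{\xi}\in A$, one has $\hat{\omega}(\boldsymbol{\xi})\le W_{s,n}$, where $W_{s,n}$ is the unique root of the equation $$x^{n+1}-w_{s,n}^{n-1}(1+w_{s,n})x+w_{s,n}^n=0$$ in the interval $(0,w_{s,n})$.
   Context: For an $s$-dimensional affine subspace $A\subset\mathbb{R}^n$, let $\mathcal{A}=\{(1,x_1,\ldots,x_n)\in\mathbb{R}^{n+1}:(x_1,\ldots,x_n)\in A\}$ and let $L_A=\mathrm{span}\,\mathcal{A}\subset\mathbb{R}^{n+1}$, a linear subspace of dimension $s+1$. The subspace $A$ is badly approximable if $$\inf_{\mathbf{m}\in\mathbb{Z}^{n+1}\smallsetminus\{0\}}\mathrm{dist}(L_A,\mathbf{m})^{n-s}\cdot\|\mathbf{m}\|^{s+1}>0.$$ Here $\|\cdot\|$ is the maximum norm. For $x\in\mathbb{R}$, $\langle x\rangle$ is the distance from $x$ to the nearest integer, and $\langle\boldsymbol{x}\rangle=(\langle x_1\rangle,\ldots,\langle x_n\rangle)$. A vector $\boldsymbol{\xi}\in\mathbb{R}^n$ is totally irrational if $1,\xi_1,\ldots,\xi_n$ are linearly independent over $\mathbb{Q}$. The uniform exponent $\hat{\omega}(\boldsymbol{\xi})$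 is the supremum of those $\gamma>0$ for which, for all $t$ large enough, there is an integer $q$ with $\|\langle q\boldsymbol{\xi}\rangle\|\le t^{-\gamma}$ and $0<q\le t$. *)

(* Defs.v *)
From HB Require Import structures.
From mathcomp Require Import all_boot all_order all_algebra.
From mathcomp Require Import all_classical all_reals all_analysis.

Set Implicit Arguments.
Unset Strict Implicit.
Unset Printing Implicit Defensive.

Import Order.TTheory GRing.Theory Num.Theory.
Import numFieldNormedType.Exports.

Local Open Scope classical_set_scope.
Local Open Scope ring_scope.

Section Definitions.
Context {R : realType}.

(* The norm on row vectors is the maximum norm. *)
Definition dist {V : normedModType R} (L : set V) (x : V) : R :=
  inf [set `|x - y| | y in L].

Definition linear_span {V : vectType R} (S : set V) : set V :=
  [set v | exists X : seq V, {in X, forall x, S x} /\ v \in <<X>>%VS].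

Definition affine_subspace (n s : nat) (A : set 'rV[R]_n) : Prop :=
  exists (p : 'rV[R]_n) (V : {vspace 'rV[R]_n}),
    \dim V = s /\ A = [set p + v | v in [set` V]].

Definition prepend1 (n : nat) (x : 'rV[R]_n) : 'rV[R]_(1 + n) :=
  row_mx (const_mx 1) x.

Definition homogenization (n : nat) (A : set 'rV[R]_n) : set 'rV[R]_(1 + n) :=
  linear_span (@prepend1 n @` A).

Definition badly_approximable (n s : nat) (A : set 'rV[R]_n) : Prop :=
  0 < inf [set dist (homogenization A) (map_mx intr m) ^+ (n - s)
               * `|map_mx intr m : 'rV[R]_(1 + n)| ^+ s.+1
          | m in [set m : 'rV[int]_(1 + n) | m != 0]].

Definition dist_int (x : R) : R := dist (range (intr : int -> R^o)) x.

Definition totally_irrational (n : nat) (xi : 'rV[R]_n) : Prop :=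
  forall c : 'rV[rat]_(1 + n),
    \sum_i ratr (c 0 i) * prepend1 xi 0 i = 0 -> c = 0.

(* Extended-real valued: the supremum is +oo when xi is rational. *)
Definition uniform_exponent (n : nat) (xi : 'rV[R]_n) : \bar R :=
  ereal_sup [set g%:E | g in [set g : R | 0 < g /\
    \forall t \near +oo, exists q : int,
      [/\ `|map_mx dist_int (q%:~R *: xi)| <= t `^ (- g),
          0 < q & q%:~R <= t]]].

Definition w_exponent (s n : nat) : R := s.+1%:R / (n - s)%:R.

Definition W_root (s n : nat) (x : R) : Prop :=
  let w := w_exponent s n in
  0 < x < w /\ x ^+ n.+1 - w ^+ n.-1 * (1 + w) * x + w ^+ n = 0.

End Definitions.

(* Main.v *)
From HB Require Import structures.
From mathcomp Require Import all_boot all_order all_algebra perm.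
From mathcomp Require Import all_classical all_reals all_analysis.
From mathcomp Require Import lra ring zify.
Require Import Defs.

(** Why the theorem is true.

    Write |<q xi>| for the distance from q xi to the integer points. For a
    positive integer q the vector q (1, xi) lies in the homogenization of A,
    within |<q xi>| of the integer point z formed by q and the integers nearest
    to q xi, and the norm of z is at most a constant times q. Bad
    approximability of A therefore gives, with w = (s + 1) / (n - s),
          c <= |<q xi>| ^ (n - s) * q ^ (s + 1),
    that is, |<q xi>| is at least a constant times q ^ (- w)
    ([badly_approximable_error]). Part (i) follows: a uniform exponent g > w
    would force the right-hand side to tend to 0 ([not_uniformly_approximable]).

    Part (ii) combines this lower bound with the inequality of Marnat and
    Moshchevitin between the ordinary and the uniform exponent. Suppose that the
    exponent alpha is uniform and put y = alpha / w. Let q_N be the best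
    denominator up to N and z_N its integer point. If z_(N+1) <> z_N then
    q_(N+1) = N + 1, and
          |<q_N xi>| << (N + 1) ^ (- alpha)  and  (N + 1) ^ y <= q_N.
    Because xi is totally irrational, no rational hyperplane contains all late
    z_N. Starting from some z_N, add a new point z_(M+1) each time it first
    leaves the rational span of the points kept so far; this produces n + 1
    linearly independent integer points, whose determinant is at least 1 in
    absolute value. At such a moment the previous point z_M still lies in the
    span, so that replacing the row z_(M+1) by z_(M+1) - (q_(M+1) / q_M) z_M does
    not change the determinant. The new row is short: its norm is at most
          2 (q_(M+1) / q_M) |<q_M xi>| << (M + 1) ^ (1 - alpha) / q_M.
    Multiplying these bounds, by induction the product of the first k + 1 row
    norms is << q_N ^ e_k, where e_k = max(0, 1 - alpha (1 + y + ... + y ^ (k-1)))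
    ([chain_extend]). If alpha (1 + y + ... + y ^ (n-1)) > 1 then e_n = 0; as the
    implied constant can be made arbitrarily small by starting late, the
    determinant would be smaller than 1 ([not_totally_irrational_of_exponents]).

    Finally the polynomial defining W factors as
    (x - w) w ^ (n-1) (x (1 + x/w + ... + (x/w) ^ (n-1)) - 1)
    ([W_polynomialE]), and the last factor is increasing in x > 0: its only
    positive root is W, and it is positive at every alpha in (W, w). *)

Set Implicit Arguments.
Unset Strict Implicit.
Unset Printing Implicit Defensive.

Import Order.TTheory GRing.Theory Num.Theory.
Import numFieldNormedType.Exports.

Local Open Scope classical_set_scope.
Local Open Scope ring_scope.

(** * Integer approximations and the lower bound from bad approximability *)

Lemma mx_norm_entry_le (R : realType) (m n : nat) (M : 'M[R]_(m, n)) i j :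
  `|M i j| <= `|M|.
Proof.
by rewrite [leRHS]/Num.norm/= mx_normrE; apply/bigmax_geP; right; exists (i, j).
Qed.

Lemma mx_norm_le (R : realType) (m n : nat) (M : 'M[R]_(m, n)) (e : R) :
  0 <= e -> (forall i j, `|M i j| <= e) -> `|M| <= e.
Proof.
move=> e0 Me; rewrite [leLHS]/Num.norm/= mx_normrE.
by rewrite (bigmax_le _ e0)// => -[i j] _; exact: Me.
Qed.

Lemma powRN_small (R : realType) (d D : R) : 0 < d -> 0 < D ->
  exists T : R, 1 <= T /\ forall t, T <= t -> t `^ (- d) <= D.
Proof.
move=> d0 D0; exists (Num.max 1 (D^-1 `^ d^-1)); split; first by rewrite le_max lexx.
move=> t; rewrite ge_max => /andP[t1 tD].
rewrite powRN -[leRHS]invrK lef_pV2 ?posrE ?invr_gt0 ?powR_gt0//; last first.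
  exact: lt_le_trans t1.
have -> : D^-1 = (D^-1 `^ d^-1) `^ d.
  by rewrite -powRrM mulVf ?gt_eqF// powRr1// invr_ge0 ltW.
by apply: ge0_ler_powR => //; rewrite ?nnegrE ?powR_ge0 ?ltW//; lra.
Qed.

Section Approximation.
Context {R : realType}.

Lemma dist_ge0 (V : normedModType R) (L : set V) x : 0 <= dist L x.
Proof.
rewrite /dist; have [->|/set0P[z Lz]] := eqVneq [set `|x - y| | y in L] set0.
  by rewrite inf0.
by apply: lb_le_inf; [exists z|move=> _ [y _ <-]].
Qed.

Lemma dist_le (V : normedModType R) (L : set V) x y : L y -> dist L x <= `|x - y|.
Proof.
by move=> Ly; apply: ge_inf; [exists 0 => _ [z _ <-]|exists y].
Qed.

Definition nearest (x : R) : int := Num.floor (x + 2^-1).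

Lemma nearest_le x (m : int) : `|x - (nearest x)%:~R| <= `|x - m%:~R|.
Proof.
have /andP[lo hi] := floor_itv (x + 2^-1); rewrite -/(nearest x) in lo hi.
rewrite intrD in hi.
have [->//|] := eqVneq m (nearest x).
rewrite neq_lt => /orP[|]; rewrite -lezD1 -(ler_int R) intrD => h.
  rewrite [leRHS]ger0_norm; last by lra.
  by rewrite ler_norml; lra.
rewrite [leRHS]ler0_norm; last by lra.
by rewrite ler_norml; lra.
Qed.

Lemma dist_intE (x : R) : dist_int x = `|x - (nearest x)%:~R|.
Proof.
apply/eqP; rewrite eq_le; apply/andP; split.
  by apply: (@dist_le R^o); exists (nearest x).
apply: lb_le_inf; first by exists `|x - 0%:~R|, 0%:~R => //; exists 0.
by move=> _ [_ [m _ <-] <-]; exact: nearest_le.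
Qed.

Lemma dist_int_le1 (x : R) : dist_int x <= 1.
Proof.
rewrite dist_intE; apply: (le_trans (nearest_le x (Num.floor x))).
have /andP[lo hi] := floor_itv x; rewrite intrD in hi.
by rewrite ler_norml; lra.
Qed.

Context {n : nat} (xi : 'rV[R]_n).

Definition error (q : nat) : R := `|map_mx dist_int (q%:R *: xi)|.

(** The integer point with first coordinate [q] closest to [q (1, xi)]. *)
Definition approx (q : nat) : 'rV[int]_(1 + n) :=
  row_mx (const_mx q%:Z) (map_mx nearest (q%:R *: xi)).

Lemma error_ge0 q : 0 <= error q. Proof. exact: normr_ge0. Qed.

Lemma approx0 q : approx q 0 0 = q%:Z.
Proof.
have -> : 0 = lshift n 0 :> 'I_(1 + n) by apply: val_inj.
by rewrite row_mxEl mxE.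
Qed.

Lemma approx_error q :
  `|map_mx intr (approx q) - q%:R *: prepend1 xi| <= error q.
Proof.
apply: mx_norm_le => [|i j]; first exact: error_ge0.
rewrite !mxE; case: split_ordP => k _; rewrite !mxE.
  by rewrite mulr1 pmulrn subrr normr0 error_ge0.
apply: (le_trans _ (mx_norm_entry_le (map_mx dist_int (q%:R *: xi)) 0 k)).
by rewrite !mxE (ord1 i) dist_intE normr_id distrC.
Qed.

Lemma approx_norm q : (0 < q)%N ->
  `|map_mx intr (approx q) : 'rV[R]_(1 + n)| <= (`|prepend1 xi| + 1) * q%:R.
Proof.
move=> q0; have q1 : 1 <= q%:R :> R by rewrite ler1n.
have e1 : error q <= 1.
  apply: mx_norm_le => // i j; rewrite mxE.
  by rewrite ger0_norm ?dist_int_le1// dist_ge0.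
rewrite -[X in `|X|](subrK (q%:R *: prepend1 xi)).
apply: (le_trans (ler_normD _ _)); rewrite normrZ normr_nat mulrDl mul1r.
have := approx_error q; lra.
Qed.

(** The point [q (1, xi)] of the homogenization is within [error q] of
    [approx q], a nonzero integer point of norm at most [C q]; the constant
    [C ^ s.+1] is absorbed into [c]. *)
Lemma badly_approximable_error (s : nat) (A : set 'rV[R]_n) :
  (s < n)%N -> badly_approximable s A -> A xi ->
  exists2 c : R, 0 < c &
    forall q : nat, (0 < q)%N -> c <= error q ^+ (n - s) * q%:R ^+ s.+1.
Proof.
move=> sn bad Axi; set C := `|prepend1 xi| + 1.
have C0 : 0 < C by rewrite ltr_wpDl.
move: bad; rewrite /badly_approximable; set S := [set _ | _ in _] => bad.
exists (inf S / C ^+ s.+1); first by rewrite divr_gt0 ?exprn_gt0.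
move=> q q0; rewrite ler_pdivrMr ?exprn_gt0//.
apply: (@le_trans _ _ (dist (homogenization A) (map_mx intr (approx q)) ^+ (n - s)
    * `|map_mx intr (approx q) : 'rV[R]_(1 + n)| ^+ s.+1)).
  apply: ge_inf; last first.
    exists (approx q) => //=; apply/negP => /eqP/matrixP/(_ 0 0).
    by rewrite approx0 mxE => -[]; lia.
  by exists 0 => _ [m _ <-]; rewrite mulr_ge0 ?exprn_ge0 ?dist_ge0.
rewrite -mulrA -exprMn ler_pM ?exprn_ge0 ?dist_ge0//.
  rewrite lerXn2r ?nnegrE ?dist_ge0 ?error_ge0//.
  apply: le_trans (approx_error q); apply: dist_le.
  exists [:: prepend1 xi]; split.
    by move=> x; rewrite inE => /eqP ->; exists xi.
  by rewrite span_seq1 memvZ// memv_line.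
rewrite lerXn2r ?nnegrE ?mulr_ge0 ?(ltW C0)//.
by rewrite mulrC; exact: approx_norm.
Qed.

(** The condition on [g] in the definition of the uniform exponent, with
    natural denominators. *)
Definition uniformly_approximable (g : R) : Prop :=
  \forall t \near +oo, exists q : nat,
    [/\ (0 < q)%N, q%:R <= t & error q <= t `^ (- g)].

Lemma uniform_exponent_le (W : R) :
  (forall g, 0 < g -> W < g -> ~ uniformly_approximable g) ->
  (uniform_exponent xi <= W%:E)%E.
Proof.
move=> h; apply: ub_ereal_sup => _ [g [g0 gP] <-]; rewrite lee_fin.
rewrite leNgt; apply/negP => /(h _ g0); apply.
apply: filterS gP => t [[q|q] [et q0 qt]]; last by [].
by exists q; split.
Qed.

(** For a uniform exponent [g] the quantity bounded below by [c] is at most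
    [t ^ (b - g a)] for every large [t], and the exponent is negative. *)
Lemma not_uniformly_approximable (a b : nat) (c g : R) :
  (0 < a)%N -> 0 < c ->
  (forall q : nat, (0 < q)%N -> c <= error q ^+ a * q%:R ^+ b) ->
  b%:R / a%:R < g -> ~ uniformly_approximable g.
Proof.
move=> a0 c0 low bg ua.
have a0R : 0 < a%:R :> R by rewrite ltr0n.
have d0 : 0 < g * a%:R - b%:R by rewrite subr_gt0 -ltr_pdivrMr.
have [T [T1 TP]] := powRN_small d0 (divr_gt0 c0 (ltr0n R 2)).
have [t Tt [q [q0 qt et]]] := pinfty_ex_ge (num_real T) ua.
have t0 : 0 < t by lra.
have := TP _ Tt; rewrite leNgt => /negP; apply.
apply: (@lt_le_trans _ _ c); first by lra.
apply: (le_trans (low _ q0)).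
have -> : t `^ (- (g * a%:R - b%:R)) = (t `^ (- g)) ^+ a * t ^+ b.
  rewrite -!powR_mulrn ?powR_ge0 ?ltW// -powRrM -powRD; last first.
    by rewrite (gt_eqF t0) implybT.
  by congr (_ `^ _); ring.
rewrite ler_pM ?exprn_ge0 ?error_ge0//.
  by rewrite lerXn2r ?nnegrE ?error_ge0 ?powR_ge0.
by rewrite lerXn2r ?nnegrE ?ler0n ?(ltW t0).
Qed.

End Approximation.

(** * Determinants and row spaces *)

Lemma det_le_prod_rows (R : realType) (m : nat) (M : 'M[R]_m) :
  `|\det M| <= m`!%:R * \prod_i `|row i M|.
Proof.
apply: (le_trans (ler_norm_sum _ _ _)).
apply: (@le_trans _ _ (\sum_(s : 'S_m) \prod_i `|row i M|)).
  apply: ler_sum => s _; rewrite normrM normr_sign mul1r normr_prod.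
  apply: ler_prod => i _; rewrite normr_ge0 /=.
  by have := mx_norm_entry_le (row i M) 0 (s i); rewrite mxE.
by rewrite sumr_const card_Sn mulr_natl.
Qed.

Lemma det_int_ge1 (m : nat) (A : 'M[int]_m) :
  row_free (map_mx intr A : 'M[rat]_m) ->
  1 <= `|\det (map_mx intr A : 'M[rat]_m)|.
Proof.
rewrite row_free_unit unitmxE unitfE det_map_mx => d0.
rewrite intr_eq0 in d0.
by rewrite -intr_norm ler1z -gtz0_ge1 normr_gt0.
Qed.

Lemma row_free_col_mx (F : fieldType) (k m : nat) (v : 'rV[F]_m) (A : 'M[F]_(k, m)) :
  row_free A -> ~~ (v <= A)%MS -> row_free (col_mx v A).
Proof.
move=> /eqP Ak vA.
have : (A < col_mx v A)%MS.
  by rewrite ltmxE -!addsmxE addsmxSr addsmx_sub submx_refl andbT.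
move=> /rank_ltmx; rewrite Ak => h.
by rewrite /row_free eqn_leq rank_leq_row.
Qed.

(** Rational subspaces of positive codimension lie in rational hyperplanes,
    which is the form in which total irrationality excludes them. *)
Lemma exists_normal_vector (F : fieldType) (k m : nat) (A : 'M[F]_(k, m)) :
  (k < m)%N -> exists2 c : 'rV[F]_m, c != 0 &
    forall v : 'rV[F]_m, (v <= A)%MS -> v *m c^T = 0.
Proof.
move=> km; have k0 : kermx A^T != 0.
  rewrite kermx_eq0 /row_free mxrank_tr; have := rank_leq_row A; lia.
exists (nz_row (kermx A^T)); first by rewrite nz_row_eq0.
move=> v /submxP[u ->]; rewrite -mulmxA.
have /sub_kermxP h := nz_row_sub (kermx A^T).
have := congr1 trmx h; rewrite trmx_mul trmxK trmx0 => ->.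
by rewrite mulmx0.
Qed.

Lemma prod_row_col_mx (T : Type) (R : comNzRingType) (k m : nat) (f : 'rV[T]_m -> R)
    (r : 'rV[T]_m) (B : 'M[T]_(k, m)) :
  \prod_i f (row i (col_mx r B)) = f r * \prod_i f (row i B).
Proof.
rewrite big_split_ord /= big_ord1 rowKu row_id; congr (_ * _).
by apply: eq_bigr => i _; rewrite rowKd.
Qed.

(** * The exponents along a chain of independent points *)

Section Exponents.
Context {R : realType} (alpha y : R).

(** For [k + 1] consecutive points of sizes growing exactly by the power [1 / y],
    [1 - alpha * \sum_(m < k) y ^+ m] is the exponent of the last denominator in
    the estimate of their exterior product. The truncation at 0 makes the
    exponent usable as a bound when later denominators replace earlier ones. *)
Definition chain_exponent (k : nat) : R :=
  Num.max 0 (1 - alpha * \sum_(m < k) y ^+ m).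

Lemma chain_exponent_ge0 k : 0 <= chain_exponent k.
Proof. by rewrite le_max lexx. Qed.

Lemma chain_exponent0 : chain_exponent 0 = 1.
Proof. by rewrite /chain_exponent big_ord0 mulr0 subr0 max_r. Qed.

Lemma chain_exponent_le1 k : 0 <= alpha -> 0 <= y -> chain_exponent k <= 1.
Proof.
move=> a0 y0; rewrite ge_max ler01/= gerBl mulr_ge0// sumr_ge0// => i _.
exact: exprn_ge0.
Qed.

(** Without the truncation this is the equality
    [1 - alpha * (1 + y * S) = (1 - alpha * S - 1) * y + (1 - alpha)]; once the
    exponent has been truncated to 0, the condition [1 - alpha <= y] says that a
    further point does not make the product grow. *)
Lemma chain_exponentS k : 1 - alpha <= y ->
  (chain_exponent k - 1) * y + (1 - alpha) <= chain_exponent k.+1.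
Proof.
move=> ay; rewrite /chain_exponent le_max.
case: (leP 0 (1 - alpha * \sum_(m < k) y ^+ m)) => _; last first.
  by apply/orP; left; lra.
have -> : \sum_(m < k.+1) y ^+ m = 1 + y * \sum_(m < k) y ^+ m.
  rewrite big_ord_recl expr0 mulr_sumr; congr (_ + _).
  by apply: eq_bigr => i _; rewrite lift0 exprS.
by apply/orP; right; lra.
Qed.

(** A geometric sum is below [1 / (1 - y)], hence [1 < alpha / (1 - y)]. *)
Lemma one_sub_le_of_lt_sum n : 0 <= alpha -> 0 <= y < 1 ->
  1 < alpha * \sum_(m < n) y ^+ m -> 1 - alpha <= y.
Proof.
move=> a0 /andP[y0 y1] h.
have e : (1 - y) * \sum_(m < n) y ^+ m = 1 - y ^+ n.
  by have := subrX1 y n => ?; lra.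
have yn := exprn_ge0 n y0.
have S0 : 0 <= \sum_(m < n) y ^+ m by rewrite sumr_ge0// => i _; exact: exprn_ge0.
nra.
Qed.

End Exponents.

(** The numerical content of adding one point: [q] is the old denominator, [q']
    the new one. As [e - 1] is nonpositive, the factor [q `^ (e - 1)] is largest
    when [q] is as small as [q' `^ y]. *)
Lemma powR_step (R : realType) (alpha y e e' q q' : R) :
  1 <= q -> 1 <= q' -> q' `^ y <= q -> e <= 1 ->
  (e - 1) * y + (1 - alpha) <= e' ->
  q' / q * q' `^ (- alpha) * q `^ e <= q' `^ e'.
Proof.
move=> q1 q'1 qq' e1 ee'.
have q0 : 0 < q by lra.
have q'0 : 0 < q' by lra.
apply: le_trans (ler_powR q'1 ee').
have -> : q' / q * q' `^ (- alpha) * q `^ e = q `^ (- (1 - e)) * q' `^ (1 - alpha).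
  have -> : - (1 - e) = e - 1 by ring.
  rewrite !powRD ?(gt_eqF q0) ?(gt_eqF q'0) ?implybT// !powRr1 ?ltW//.
  by rewrite powR_inv1 ?ltW//; ring.
rewrite (@powRD _ q' ((e - 1) * y)) ?(gt_eqF q'0) ?implybT// ler_wpM2r ?powR_ge0//.
have -> : (e - 1) * y = - (y * (1 - e)) by ring.
rewrite !powRN lef_pV2 ?posrE ?powR_gt0// powRrM.
by apply: ge0_ler_powR => //; rewrite ?nnegrE ?powR_ge0; lra.
Qed.

(** * Best approximation denominators *)

Section Best.
Context {R : realType} {n : nat} (xi : 'rV[R]_n).

(** The smallest denominator in [1, N] minimizing the error (and 1 for [N = 0]). *)
Fixpoint best (N : nat) : nat :=
  if N is N'.+1 then
    if error xi N < error xi (best N') then N else best N'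
  else 1.

Lemma best_gt0 N : (0 < best N)%N.
Proof. by elim: N => //= N IH; case: ifP. Qed.

Lemma best_le N : (0 < N)%N -> (best N <= N)%N.
Proof.
elim: N => //= N IH _; case: ifP => // h.
by case: N IH h => [|N] IH; [rewrite ltxx|have := IH erefl; lia].
Qed.

Lemma best_min N q : (0 < q <= N)%N -> error xi (best N) <= error xi q.
Proof.
elim: N q => [|N IH] q; first by lia.
move=> /andP[q0]; rewrite leq_eqVlt ltnS /= => /orP[/eqP->|qN].
  by case: ifP => [//|/negbT]; rewrite -leNgt.
have {}IH : error xi (best N) <= error xi q by apply: IH; rewrite q0.
by case: ifP => // /ltW /le_trans; apply.
Qed.

Lemma best_step N : best N.+1 = best N \/
  best N.+1 = N.+1 /\ error xi N.+1 < error xi (best N).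
Proof. by rewrite /=; case: ifP; [right|left]. Qed.

Lemma best_homo : {homo best : M N / (M <= N)%N}.
Proof.
apply: homo_leq => // [j i k|N]; first exact: leq_trans.
case: (best_step N) => [->//|[-> _]].
by case: N => // N; rewrite leqW// best_le.
Qed.

(** Any exponent [a] smaller than a uniform exponent [g] leaves room for an
    arbitrarily small constant and for the passage from [N] to [N + 1]. *)
Lemma best_error_small (g a : R) : 0 < g -> a < g -> uniformly_approximable xi g ->
  forall D, 0 < D -> exists N0 : nat, forall N, (N0 <= N)%N ->
    error xi (best N) <= D * (N.+1%:R `^ (- a)).
Proof.
move=> g0 ag [T [_ TP]] D D0.
have ag0 : 0 < g - a by rewrite subr_gt0.
have [T' [T'1 T'P]] := powRN_small ag0 (divr_gt0 D0 (powR_gt0 g (ltr0n R 2))).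
pose M := Num.max T T'.
exists (Num.truncn M).+1 => N N0.
have MN : M < N%:R.
  by apply: (lt_le_trans (truncnS_gt M)); rewrite ler_nat.
move: MN; rewrite gt_max => /andP[TN T'N].
have [q [q0 qN eq]] := TP _ TN.
rewrite ler_nat in qN.
have q0N : (0 < q <= N)%N by rewrite q0.
apply: (le_trans (best_min q0N)); apply: (le_trans eq).
have N0' : (0 < N)%N by apply: leq_trans N0.
have NR : 1 <= N%:R :> R by rewrite ler1n.
have SN : N.+1%:R <= 2 * N%:R :> R by rewrite -natr1; lra.
have SN0 : 0 < N.+1%:R :> R by rewrite ltr0n.
(* the factor 2 ^ g compares N with N + 1 *)
apply: (@le_trans _ _ (2 `^ g * N.+1%:R `^ (- g))).
  rewrite !powRN -ler_pdivrMl ?powR_gt0// -invfM lef_pV2 ?posrE ?mulr_gt0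
    ?powR_gt0 ?ltr0n//.
  rewrite -powRM//; by apply: ge0_ler_powR => //; rewrite ?nnegrE; lra.
 have -> : - g = - (g - a) + - a by ring.
rewrite powRD; last by rewrite (gt_eqF SN0) implybT.
rewrite mulrA ler_wpM2r ?powR_ge0// mulrC -ler_pdivlMr ?powR_gt0//.
by apply: T'P; rewrite -natr1; lra.
Qed.

End Best.

(** * Chains of independent best approximations *)

Section Chain.
Context {R : realType} {n : nat} (xi : 'rV[R]_n).

Definition best_point (N : nat) : 'rV[rat]_(1 + n) :=
  map_mx intr (approx xi (best xi N)).

Lemma map_ratr_intr k m (A : 'M[int]_(k, m)) :
  map_mx ratr (map_mx intr A : 'M[rat]_(k, m)) = map_mx intr A :> 'M[R]_(k, m).
Proof. by apply/matrixP => i j; rewrite !mxE ratr_int. Qed.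

(** If [c] is orthogonal to all late points [z_N] then
    [q_N * (c, (1, xi)) = (c, q_N (1, xi) - z_N)], which tends to 0, so that
    [(c, (1, xi)) = 0] against total irrationality. *)
Lemma best_point_off_hyperplane (c : 'rV[rat]_(1 + n)) (N0 : nat) :
  totally_irrational xi -> c != 0 ->
  (forall D : R, 0 < D -> exists N1, forall N, (N1 <= N)%N ->
     error xi (best xi N) <= D) ->
  exists2 N, (N0 <= N)%N & best_point N *m c^T != 0.
Proof.
move=> irr c0 small; apply: contrapT => no.
move/eqP: c0; apply; apply: irr; apply/eqP; rewrite -normr_le0.
set X := \sum_i _; pose S : R := \sum_i `|ratr (c 0 i)|.
have S0 : 0 <= S by rewrite sumr_ge0.
apply/ler_addgt0Pl => e e0; rewrite addr0.
have [N1 N1P] := small (e / (S + 1)) (divr_gt0 e0 (ltr_wpDl S0 ltr01)).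
pose N := maxn N0 N1; pose q := best xi N.
have qe := N1P N (leq_maxr _ _).
have z : best_point N *m c^T = 0.
  have [//|h] := eqVneq (best_point N *m c^T) 0.
  by case: no; exists N => //; exact: leq_maxl.
pose v : 'rV[R]_(1 + n) := q%:R *: prepend1 xi - map_mx intr (approx xi q).
have -> : `|X| = `|\sum_i ratr (c 0 i) * v 0 i| / q%:R.
  have q0 : q%:R != 0 :> R by rewrite pnatr_eq0 -lt0n best_gt0.
  rewrite -[X in _ / X](@ger0_norm _ q%:R) // -normf_div; congr (`|_|).
  transitivity ((q%:R * X - \sum_i ratr (c 0 i) * (approx xi q 0 i)%:~R) / q%:R).
    have := congr1 (fun M : 'M[rat]_1 => ratr (M 0 0) : R) z.
    rewrite !mxE raddf0 rmorph_sum /= => h.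
    under [X in _ - X]eq_bigr => i _.
      have -> : ratr (c 0 i) * (approx xi q 0 i)%:~R
         = ratr (best_point N 0 i * c^T i 0) :> R.
        by rewrite !mxE rmorphM /= ratr_int mulrC.
      over.
    by rewrite h subr0 mulrAC mulfV// mul1r.
  congr (_ / _); rewrite mulr_sumr -sumrB; apply: eq_bigr => i _.
  by rewrite !mxE; ring.
have q1 : 1 <= q%:R :> R by rewrite ler1n best_gt0.
rewrite ler_pdivrMr; last by lra.
apply: (@le_trans _ _ e); last by rewrite ler_peMr // ltW.
apply: (le_trans (ler_norm_sum _ _ _)).
apply: (@le_trans _ _ (S * (e / (S + 1)))).
  rewrite mulr_suml ler_sum// => i _; rewrite normrM ler_wpM2l//.
  apply: (le_trans (mx_norm_entry_le v 0 i)); rewrite /v distrC.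
  exact: le_trans (approx_error xi q) qe.
by rewrite mulrCA ler_piMr ?(ltW e0)// ler_pdivrMr; lra.
Qed.

(** [A] collects [k + 1] independent integer points whose rational span contains
    the current best point, and [B] the rows obtained from them by the
    determinant-preserving operations [U]. The product of the norms of the rows
    of [B] plays the role of the height of that span; each new point contributes
    a factor [D]. *)
Definition chain (C D : R) (ex : nat -> R) (k N : nat) : Prop :=
  exists (A : 'M[int]_(k.+1, 1 + n)) (B : 'M[rat]_(k.+1, 1 + n)) (U : 'M[rat]_k.+1),
    let AQ := map_mx intr A in
    [/\ row_free AQ, (best_point N <= AQ)%MS, \det U = 1, B = U *m AQ &
      \prod_i `|map_mx ratr (row i B) : 'rV[R]_(1 + n)|
        <= C * D ^+ k * (best xi N)%:R `^ (ex k)].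

(** Subtracting the multiple of the previous best point that cancels the first
    coordinate replaces both points by their errors. *)
Lemma chain_step_norm (N : nat) (r : 'rV[rat]_(1 + n)) :
  let q := best xi N in let q' := best xi N.+1 in
  (q <= q')%N -> error xi q' <= error xi q ->
  r = best_point N.+1 - (q'%:R / q%:R) *: best_point N ->
  `|map_mx ratr r : 'rV[R]_(1 + n)| <= 2 * (q'%:R / q%:R) * error xi q.
Proof.
move=> q q' qq' ee ->.
have q0 : 0 < q%:R :> R by rewrite ltr0n best_gt0.
have lam1 : 1 <= q'%:R / q%:R :> R by rewrite ler_pdivlMr// mul1r ler_nat.
have -> : map_mx ratr (best_point N.+1 - (q'%:R / q%:R) *: best_point N)
   = (map_mx intr (approx xi q') - q'%:R *: prepend1 xi)
     - (q'%:R / q%:R) *: (map_mx intr (approx xi q) - q%:R *: prepend1 xi)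
   :> 'rV[R]_(1 + n).
  apply/matrixP => i j; rewrite !mxE rmorphB rmorphM fmorph_div /=.
  by rewrite !ratr_int !ratr_nat; field; rewrite gt_eqF.
apply: (le_trans (ler_normB _ _)); rewrite normrZ (@ger0_norm _ (_ / _)); last by lra.
have h1 := approx_error xi q'; have h2 := approx_error xi q.
have h3 := error_ge0 xi q.
nra.
Qed.

End Chain.

Section Transference.
Context {R : realType} {n : nat} (xi : 'rV[R]_n) (alpha y : R).

Let e := chain_exponent alpha y.
Let C : R := `|prepend1 xi| + 1.

Lemma chain_start D N : chain xi C D e 0 N.
Proof.
set v := approx xi (best xi N).
have v0 : map_mx intr v != 0 :> 'rV[rat]_(1 + n).
  apply/eqP => /matrixP/(_ 0 0); rewrite mxE approx0 mxE => /eqP.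
  by rewrite intr_eq0; have := best_gt0 xi N; lia.
exists v, (map_mx intr v), 1%:M; split.
- by rewrite /row_free rank_rV v0.
- exact: submx_refl.
- exact: det1.
- by rewrite mul1mx.
rewrite big_ord1 expr0 mulr1 /e chain_exponent0 powRr1//.
rewrite (_ : row 0 _ = map_mx intr v); last first.
  by apply/rowP => j; rewrite !mxE.
by rewrite map_ratr_intr; apply: approx_norm; exact: best_gt0.
Qed.

(** The point added is the first best point outside the span of [A]. Its
    predecessor is in the span, which makes the reduction of the new row a row
    operation. The previous exponent may be applied to the predecessor although
    its denominator can be much larger than that of the last point added, because
    exponents are nonnegative and best denominators increase. *)
Lemma chain_extend D k N :
  0 <= alpha -> 0 <= y -> 1 - alpha <= y -> 0 < D -> (k < n)%N ->
  (forall c : 'rV[rat]_(1 + n), c != 0 ->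
     exists2 M, (N <= M)%N & best_point xi M *m c^T != 0) ->
  (forall M, (N <= M)%N -> 2 * error xi (best xi M) <= D * M.+1%:R `^ (- alpha)) ->
  (forall M, (N <= M)%N -> M.+1%:R `^ y <= (best xi M)%:R) ->
  chain xi C D e k N ->
  exists2 M, (N <= M)%N & chain xi C D e k.+1 M.
Proof.
move=> a0 y0 ay D0 kn off small large [A [B [U]]].
set AQ := map_mx intr A => -[Af zA U1 BU prodB].
have [c c0 cA] := @exists_normal_vector _ _ _ AQ kn.
have ex : exists M, (N <= M)%N && ~~ (best_point xi M <= AQ)%MS.
  have [M NM Mc] := off c c0; exists M; rewrite NM /=.
  by apply: contra Mc => /cA ->.
case: (ex_minnP ex) => -[|M] /andP[NM MA] Mmin.
  by move: NM MA; rewrite leqn0 => /eqP N0; rewrite -[X in best_point xi X]N0 zA.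
have {}NM : (N <= M)%N.
  by move: NM; rewrite leq_eqVlt => /orP[/eqP NM|//]; rewrite -NM zA in MA.
have MA' : (best_point xi M <= AQ)%MS.
  apply: contraT => h; have := Mmin M; rewrite NM h => /(_ isT); lia.
have [bM|[bM eM]] := best_step xi M.
  by move: MA; rewrite /best_point bM -/(best_point xi M) MA'.
exists M.+1; first exact: leqW.
set q := best xi M; set q' := best xi M.+1.
have /submxP[w wA] := MA'.
pose u := - (q'%:R / q%:R) *: w.
exists (col_mx (approx xi q') A).
exists (col_mx (best_point xi M.+1 - (q'%:R / q%:R) *: best_point xi M) B).
exists (block_mx 1%:M u 0 U); cbv zeta.
rewrite (_ : map_mx intr _ = col_mx (best_point xi M.+1) AQ); last exact: map_col_mx.
split.
- exact: row_free_col_mx.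
- by apply: submx_trans (addsmxSl _ AQ) _; rewrite addsmxE submx_refl.
- by apply: (etrans (det_ublock _ u U)); rewrite det1 mul1r.
- symmetry; apply: (etrans (mul_block_col 1%:M u 0 U _ AQ)).
  rewrite mul1mx mul0mx add0r -BU.
  by rewrite -scalemxAl -wA scaleNr.
rewrite [leLHS](prod_row_col_mx (fun r => `|map_mx ratr r : 'rV[R]_(1 + n)|)).
have q0 := best_gt0 xi M; have q'0 := best_gt0 xi M.+1.
have qq' : (q <= q')%N by exact: best_homo.
have q1 : 1 <= q%:R :> R by rewrite ler1n.
have q'1 : 1 <= q'%:R :> R by rewrite ler1n.
have step := @chain_step_norm _ _ xi M _ qq' _ erefl.
rewrite -/q -/q' in step.
have eq' : error xi q' <= error xi q by rewrite /q' bM ltW.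
have {eq'}step := step eq'.
have C0 : 0 <= C by rewrite addr_ge0.
apply: (@le_trans _ _ ((D * (q'%:R / q%:R * q'%:R `^ (- alpha)))
    * (C * D ^+ k * q%:R `^ e k))).
  apply: ler_pM => //; first by rewrite prodr_ge0.
    apply: (le_trans step); have := small M NM; rewrite -bM -/q -/q' => h.
    rewrite (_ : 2 * _ * _ = (q'%:R / q%:R) * (2 * error xi q)); last by ring.
    rewrite (_ : D * _ = (q'%:R / q%:R) * (D * q'%:R `^ (- alpha))); last by ring.
    by apply: ler_wpM2l => //; rewrite divr_ge0.
  apply: (le_trans prodB); rewrite ler_wpM2l ?mulr_ge0 ?exprn_ge0 ?(ltW D0)//.
  apply: ge0_ler_powR; rewrite ?nnegrE ?chain_exponent_ge0//.
  by rewrite ler_nat; exact: best_homo.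
rewrite [leLHS](_ : _ = C * D ^+ k.+1 *
   (q'%:R / q%:R * q'%:R `^ (- alpha) * q%:R `^ e k)); last by rewrite exprS; ring.
rewrite ler_wpM2l ?mulr_ge0 ?exprn_ge0 ?(ltW D0)//.
apply: (@powR_step _ alpha y) => //.
- by rewrite /q' bM; exact: large.
- exact: chain_exponent_le1.
- exact: chain_exponentS.
Qed.

(** The Marnat-Moshchevitin inequality, in the following form: if the error is
    eventually smaller than any multiple of [N ^ (- alpha)] and the best
    denominator up to [N] is at least about [N ^ y], then
    [alpha * \sum_(m < n) y ^+ m <= 1] for totally irrational [xi]. Otherwise the
    last exponent of a complete chain is 0, and the determinant of the chain is
    at most a constant times [D], contradicting [det_int_ge1]. *)
Lemma not_totally_irrational_of_exponents :
  (0 < n)%N -> 0 <= alpha -> 0 <= y < 1 ->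
  1 < alpha * \sum_(m < n) y ^+ m ->
  (forall D, 0 < D -> exists N0 : nat, forall N, (N0 <= N)%N ->
     error xi (best xi N) <= D * N.+1%:R `^ (- alpha)) ->
  (exists N0 : nat, forall N, (N0 <= N)%N -> N.+1%:R `^ y <= (best xi N)%:R) ->
  ~ totally_irrational xi.
Proof.
move=> n0 a0 y01 ay small [N1 large] irr.
have /andP[y0 y1] := y01.
have y_ge := one_sub_le_of_lt_sum a0 y01 ay.
have off (c : 'rV[rat]_(1 + n)) N : c != 0 ->
    exists2 M, (N <= M)%N & best_point xi M *m c^T != 0.
  move=> c0; apply: best_point_off_hyperplane => // D D0.
  have [N0 N0P] := small D D0; exists N0 => M /N0P /le_trans; apply.
  rewrite ler_piMr ?(ltW D0)// powRN invf_le1 ?powR_gt0 ?ltr0n//.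
  by rewrite -[leLHS](powRr0 M.+1%:R) ler_powR// ler1n.
pose K : R := (1 + n)`!%:R * C.
have K0 : 0 < K by rewrite mulr_gt0 ?ltr0n ?fact_gt0// ltr_wpDl.
(* |det| will be at most K * D ^ n, and n > 0 *)
pose D := (K + 1)^-1.
have D0 : 0 < D by rewrite invr_gt0 addr_gt0.
have [N2 N2P] := small (D / 2) (divr_gt0 D0 (ltr0n R 2)).
have chains k : (k <= n)%N ->
    exists2 N, (maxn N1 N2 <= N)%N & chain xi C D e k N.
  elim: k => [_|k IH kn]; first by exists (maxn N1 N2) => //; exact: chain_start.
  have [N NN ch] := IH (ltnW kn).
  move: (NN); rewrite geq_max => /andP[NN1 NN2].
  have [M NM chM] : exists2 M, (N <= M)%N & chain xi C D e k.+1 M.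
    apply: chain_extend => //.
    - by move=> c; exact: off.
    - move=> M NM; have := N2P M (leq_trans NN2 NM); lra.
    - by move=> M NM; exact: large (leq_trans NN1 NM).
  by exists M => //; exact: leq_trans NM.
have [N _ [A [B [U [Af _ U1 BU prodB]]]]] := chains n (leqnn n).
have dA := det_int_ge1 Af.
have dB : \det B = \det (map_mx intr A : 'M[rat]_(n.+1)) by rewrite BU det_mulmx U1 mul1r.
have en : e n = 0 by rewrite /e /chain_exponent max_l//; lra.
have : 1 <= `|\det (map_mx ratr B : 'M[R]_(n.+1))|.
  by rewrite det_map_mx dB -ratr_norm -[1](ratr_nat R 1) ler_rat.
apply/negP; rewrite -ltNge; apply: (le_lt_trans (det_le_prod_rows _)).
under eq_bigr do rewrite -map_row.
move: prodB; rewrite en powRr0 mulr1 => prodB.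
apply: (@le_lt_trans _ _ (K * D ^+ n)).
  by rewrite /K -mulrA ler_wpM2l.
have D1 : D <= 1 by rewrite invf_le1 ?addr_gt0//; lra.
apply: (@le_lt_trans _ _ (K * D)).
  rewrite ler_wpM2l ?(ltW K0)// -(prednK n0) exprS ler_piMr ?(ltW D0)//.
  by rewrite exprn_ile1 ?(ltW D0).
by rewrite /D ltr_pdivrMr ?addr_gt0//; lra.
Qed.

End Transference.

(** * The polynomial defining W *)

Section RegularSystem.
Context {R : realType} (n : nat) (w : R).
Hypotheses (n0 : (0 < n)%N) (w0 : 0 < w).

(** The left-hand side [alpha * \sum_(m < n) y ^+ m] of the transference
    inequality for [alpha = x] and the growth rate [y = x / w]. *)
Definition regular_sum (x : R) : R := x * \sum_(m < n) (x / w) ^+ m.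

(** Telescoping the geometric sum in [regular_sum] by the factor [x - w]. *)
Lemma W_polynomialE x :
  x ^+ n.+1 - w ^+ n.-1 * (1 + w) * x + w ^+ n
    = (x - w) * (w ^+ n.-1 * (regular_sum x - 1)).
Proof.
rewrite /regular_sum; set S := \sum_(m < n) _.
have wN0 : w != 0 by rewrite gt_eqF.
have tele : (x - w) * S = w * ((x / w) ^+ n - 1).
  by rewrite subrX1 mulrA -/S; congr (_ * _); field.
have wn : w ^+ n = w ^+ n.-1 * w by rewrite -exprSr prednK.
have xn : x ^+ n = w ^+ n * (x / w) ^+ n.
  by rewrite -exprMn; congr (_ ^+ _); field.
transitivity (w ^+ n.-1 * (x * ((x - w) * S) - (x - w))); last by ring.
by rewrite tele exprS xn wn; ring.
Qed.

Lemma regular_sum_lt x x' : 0 <= x -> x < x' -> regular_sum x < regular_sum x'.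
Proof.
move=> x0 xx'; rewrite /regular_sum.
have S0 : 0 < \sum_(m < n) (x / w) ^+ m.
  rewrite -(prednK n0) big_ord_recl expr0 ltr_pwDl// sumr_ge0// => i _.
  by rewrite exprn_ge0// divr_ge0 ?(ltW w0).
apply: (@lt_le_trans _ _ (x' * \sum_(m < n) (x / w) ^+ m)).
  by rewrite ltr_pM2r.
rewrite ler_wpM2l//; first lra.
apply: ler_sum => i _; rewrite lerXn2r ?nnegrE ?divr_ge0 ?(ltW w0)//; first lra.
by rewrite ler_pM2r ?invr_gt0// ltW.
Qed.

Lemma regular_sum_root : 1 < w * n%:R ->
  exists2 x : R, 0 < x < w & regular_sum x = 1.
Proof.
move=> wn; pose p : {poly R} := 'X * (\sum_(m < n) (w^-1 *: 'X) ^+ m) - 1.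
have pE x : p.[x] = regular_sum x - 1.
  rewrite /p !hornerE horner_sum; congr (_ * _ - _).
  by apply: eq_bigr => i _; rewrite !hornerE mulrC.
have g0 : regular_sum 0 = 0 by rewrite /regular_sum mul0r.
have gw : regular_sum w = w * n%:R.
  rewrite /regular_sum divff ?gt_eqF//; congr (_ * _).
  by under eq_bigr do rewrite expr1n; rewrite sumr_const card_ord.
have [|x /andP[x0 xw]] := @poly_ivt R p 0 w (ltW w0).
  by rewrite !pE g0 gw; apply/andP; split; lra.
rewrite /root pE subr_eq0 => /eqP gx; exists x => //.
rewrite !lt_neqAle x0 xw !andbT; apply/andP; split; apply/eqP => h.
  by move: gx; rewrite -h g0 => /eqP; rewrite eq_sym oner_eq0.
by move: gx; rewrite h gw; lra.
Qed.

End RegularSystem.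

(** * The two bounds for the uniform exponent *)

Section MainBound.
Context {R : realType} {n : nat} (xi : 'rV[R]_n).

(** The lower bound for the error at the best denominator [q] up to [N], against
    its upper bound [D (N + 1) ^ (- alpha)], bounds [N + 1] by a power of [q];
    choosing [D] small against [c] removes the constants. *)
Lemma best_growth (a b : nat) (c alpha : R) :
  (0 < a)%N -> (0 < b)%N -> 0 < c ->
  (forall q : nat, (0 < q)%N -> c <= error xi q ^+ a * q%:R ^+ b) ->
  (forall D, 0 < D -> exists N0 : nat, forall N, (N0 <= N)%N ->
     error xi (best xi N) <= D * N.+1%:R `^ (- alpha)) ->
  exists N0 : nat, forall N, (N0 <= N)%N ->
    N.+1%:R `^ (alpha / (b%:R / a%:R)) <= (best xi N)%:R.
Proof.
move=> a0 b0 c0 low small.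
have D0 : 0 < Num.min 1 c by rewrite lt_min ltr01.
have [N0 N0P] := small _ D0; exists N0 => N /N0P eN.
set D := Num.min 1 c in D0 eN; set q := best xi N in eN *.
have b0R : 0 < b%:R :> R by rewrite ltr0n.
have a0R : 0 < a%:R :> R by rewrite ltr0n.
have t0 : 0 < N.+1%:R :> R by rewrite ltr0n.
have Da : D ^+ a <= c.
  apply: (@le_trans _ _ D); last by rewrite /D ge_min lexx orbT.
  rewrite -(prednK a0) exprS ler_piMr ?(ltW D0)// exprn_ile1 ?(ltW D0)//.
  by rewrite /D ge_min lexx.
have key : N.+1%:R `^ (alpha * a%:R) <= q%:R ^+ b.
  have h : c <= D ^+ a * ((N.+1%:R `^ (alpha * a%:R))^-1 * q%:R ^+ b).
    apply: (le_trans (low q (best_gt0 xi N))).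
    rewrite mulrA ler_wpM2r ?exprn_ge0//.
    rewrite powRrM powR_mulrn ?powR_ge0// -exprVn -exprMn -powRN.
    by rewrite lerXn2r ?nnegrE ?error_ge0// mulr_ge0 ?powR_ge0// ltW.
  rewrite -[leLHS]mulr1 -ler_pdivlMl ?powR_gt0//.
  rewrite -(ler_pM2l c0) mulr1; apply: (le_trans h).
  by rewrite ler_wpM2r// mulr_ge0 ?invr_ge0 ?powR_ge0 ?exprn_ge0.
rewrite (_ : alpha / _ = alpha * a%:R * b%:R^-1); last by field; lra.
rewrite powRrM.
have -> : q%:R = (q%:R ^+ b) `^ b%:R^-1 :> R.
  by rewrite -powR_mulrn// -powRrM mulfV ?gt_eqF// powRr1.
by apply: ge0_ler_powR => //; rewrite ?nnegrE ?powR_ge0 ?exprn_ge0 ?invr_ge0.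
Qed.

(** If some [g > W] were uniform, any [alpha] between [W] and the minimum of [g]
    and [w] would violate the transference inequality, since [regular_sum] is
    increasing and equals 1 at [W]. *)
Lemma uniform_exponent_le_regular (a b : nat) (c W : R) :
  (0 < n)%N -> (0 < a)%N -> (0 < b)%N -> 0 < c ->
  (forall q : nat, (0 < q)%N -> c <= error xi q ^+ a * q%:R ^+ b) ->
  0 < W < b%:R / a%:R -> regular_sum n (b%:R / a%:R) W = 1 ->
  totally_irrational xi -> (uniform_exponent xi <= W%:E)%E.
Proof.
move=> n0 a0 b0 c0 low /andP[W0 Ww] gW irr.
set w := b%:R / a%:R in Ww gW *.
have w0 : 0 < w by rewrite divr_gt0 ?ltr0n.
apply: uniform_exponent_le => g g0 Wg ua.
(* alpha < g absorbs constants; alpha < w makes y = alpha / w smaller than 1 *)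
pose alpha := (W + Num.min g w) / 2.
have Wm : W < Num.min g w by rewrite lt_min Wg.
have mg : Num.min g w <= g by rewrite ge_min lexx.
have mw : Num.min g w <= w by rewrite ge_min lexx orbT.
have aW : W < alpha by rewrite /alpha; lra.
have ag : alpha < g by rewrite /alpha; lra.
have aw : alpha < w by rewrite /alpha; lra.
have small := best_error_small g0 ag ua.
apply: (not_totally_irrational_of_exponents n0 _ _ _ small
  (best_growth a0 b0 c0 low small) irr); rewrite -/w.
- by lra.
- by rewrite divr_ge0 ?ltr_pdivrMr ?mul1r ?(ltW w0) ?aw//=; lra.
- rewrite -gW; apply: regular_sum_lt => //; exact: ltW.
Qed.

End MainBound.

Unset Implicit Arguments.

Theorem proposition5p1 (R : realType) (n s : nat) (A : set 'rV[R]_n)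
    (hn : (2 <= n)%N) (hs : (s <= n - 1)%N)
    (hA : affine_subspace s A) (hbad : badly_approximable s A) :
  (forall xi : 'rV[R]_n, A xi ->
     (uniform_exponent xi <= (w_exponent s n)%:E)%E) /\
  ((1 <= s)%N ->
     exists W : R, unique (W_root s n) W /\
       forall xi : 'rV[R]_n, A xi -> totally_irrational xi ->
         (uniform_exponent xi <= W%:E)%E).
Proof.
have sn : (s < n)%N by lia.
have ns0 : (0 < n - s)%N by lia.
have n0 : (0 < n)%N by lia.
split=> [xi Axi|s1].
  have [c c0 low] := badly_approximable_error sn hbad Axi.
  by apply: uniform_exponent_le => g _ wg; exact: not_uniformly_approximable low wg.
have w0 : 0 < w_exponent s n :> R by rewrite divr_gt0 ?ltr0n.
have wn : 1 < w_exponent s n * n%:R :> R.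
  rewrite /w_exponent mulrAC ltr_pdivlMr ?ltr0n// mul1r -natrM ltr_nat; nia.
have [W W0w gW] := regular_sum_root w0 wn.
exists W; split; last first.
  move=> xi Axi irr; have [c c0 low] := badly_approximable_error sn hbad Axi.
  exact: uniform_exponent_le_regular low W0w gW irr.
split=> [|x [/andP[x0 xw]]]; rewrite /W_root W_polynomialE//.
  by split=> //; rewrite gW subrr !mulr0.
move=> /eqP; rewrite !mulf_eq0 expf_eq0 (gt_eqF w0) andbF subr_eq0 (lt_eqF xw) /=.
rewrite subr_eq0 => /eqP gx; have /andP[W0 _] := W0w.
have [Wx|xW|//] := ltgtP W x.
  by have := regular_sum_lt n0 w0 (ltW W0) Wx; rewrite gx gW ltxx.
by have := regular_sum_lt n0 w0 (ltW x0) xW; rewrite gx gW ltxx.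
Qed.
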